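(* Let $\bar\Omega$ be the closure of an open subset $\Omega\subset\mathbb{R}^{N+1}$, and let $G:\bar\Omega\to\mathbb{R}^N$, $(u,\lambda)\mapsto G(u,\lambda)$ with $u\in\mathbb{R}^N$, $\lambda\in\mathbb{R}$, be continuously differentiable in $\bar\Omega$. Let $x_0=(u_0,\lambda_0)\in\bar\Omega$ be a solution to $G(u_0,\lambda_0)=0$, and let $\mathcal{N}(x_0,s_0)=0$ with $\|\dot x_0\|=1$, where $\dot x_0=(\dot u_0^T,\dot\lambda_0)^T$ and $\mathcal{N}(x,s)=\dot x_0^T(x-x_0)-(s-s_0)$. Let $\tau\ge0$ be such that $\|G_u\dot u_0+G_\lambda\dot\lambda_0\|\le\tau$ for all $(u,\lambda)\in\bar\Omega$, where $G_u$ and $G_\lambda$ are evaluated at $(u,\lambda)$. Assume that there exists $\alpha>0$ such that for all $(u,\lambda)\in\bar\Omega$ $$\sigma_{N-1}>0,\qquad \max\left\{\sigma_N^2,\ (u_N^TG_\lambda)^2\,\frac{\mathrm{gap}}{\mathrm{gap}+\xi^2}\right\}\ge\alpha,$$ where $\mathrm{gap}\equiv\sigma_{N-1}^2-\sigma_N^2$ and $\xi\equiv|u_N^TG_\lambda|+\|(I-u_Nu_N^T)G_\lambda\|$, and assume $\tau<\alpha$. Assume moreover that $$G_u=I+K(u)+E$$ with $\mathrm{rank}(K(u))=p$. Then there is a matrix $\mathcal{K}(u)$ of rank at most $p+2$ such that $$\|F_x-I-\mathcal{K}(u)\|\le\|E\|.$$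
   Context: $\|\cdot\|$ is the Euclidean vector norm and the induced matrix norm. $G_u=\partial G/\partial u$ is the $N\times N$ Jacobian with respect to $u$, and $G_\lambda=\partial G/\partial\lambda\in\mathbb{R}^N$. At each $(u,\lambda)$, $G_u(u,\lambda)=U\Sigma V^T$ is a singular value decomposition with $\Sigma=\mathrm{diag}(\sigma_1,\dots,\sigma_N)$, $\sigma_1\ge\dots\ge\sigma_N\ge0$, and $u_N=Ue_N$ is the last column of $U$, a left singular vector for $\sigma_N$. The quantities $\sigma_{N-1},\sigma_N,u_N,\mathrm{gap},\xi$ depend on $(u,\lambda)$. The vector $\dot x_0=(\dot u_0^T,\dot\lambda_0)^T\in\mathbb{R}^{N+1}$, with $\dot u_0\in\mathbb{R}^N$ and $\dot\lambda_0\in\mathbb{R}$, is a fixed vector (an approximation to the tangent of the solution path at $x_0$), and $s_0$ is a real arclength value. The extended map of pseudo-arclength continuation is $$F(x,s)=\begin{pmatrix}G(x)\\ \mathcal{N}(x,s)\end{pmatrix},\qquad x=(u^T,\lambda)^T,$$ so that $F_x=\begin{pmatrix}G_u&G_\lambda\\ \dot u_0^T&\dot\lambda_0\end{pmatrix}$, an $(N+1)\times(N+1)$ matrix with $G_u,G_\lambda$ evaluated at $x=(u,\lambda)$. In the decomposition $G_u=I+K(u)+E$ (at the given point $(u,\lambda)\in\bar\Omega$), $K(u)$ and $E$ are $N\times N$ matrices, $K(u)$ being thought of as low rank and $E$ as small; in $F_x-I-\mathcal{K}(u)$, $I$ is the $(N+1)\times(N+1)$ identity and $\mathcal{K}(u)$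 is $(N+1)\times(N+1)$. *)

(* Defs.v *)
From HB Require Import structures.
From mathcomp Require Import all_boot all_order all_algebra.
From mathcomp Require Import all_classical all_reals all_analysis.
Set Implicit Arguments.
Unset Strict Implicit.
Unset Printing Implicit Defensive.
Import Order.TTheory GRing.Theory Num.Theory.
Import numFieldNormedType.Exports.
Local Open Scope classical_set_scope.
Local Open Scope ring_scope.

Definition vdot (R : realType) n (v w : 'cV[R]_n) : R := (v^T *m w) 0 0.

(* The norm that the library puts on matrices is the max norm (its topology is
   the usual one), so the Euclidean and spectral norms are defined here. *)
Definition enorm (R : realType) n (v : 'cV[R]_n) : R :=
  Num.sqrt (\sum_(i < n) v i 0 ^+ 2).

Definition opnorm (R : realType) m n (A : 'M[R]_(m, n)) : R :=
  sup [set enorm (A *m v) | v in [set v : 'cV[R]_n | enorm v <= 1]].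

Definition is_svd (R : realType) n
    (A U : 'M[R]_n) (sigma : 'rV[R]_n) (V : 'M[R]_n) : Prop :=
  [/\ U^T *m U = 1%:M,
      V^T *m V = 1%:M,
      A = U *m diag_mx sigma *m V^T,
      forall i j : 'I_n, (i <= j)%N -> sigma 0 j <= sigma 0 i
    & forall i : 'I_n, 0 <= sigma 0 i].

(* Column convention: row i is the gradient of the i-th component of f
   (the library's [jacobian] acts on row vectors and is the transpose). *)
Definition jac (R : realType) m n (f : 'cV[R]_n -> 'cV[R]_m) (x : 'cV[R]_n) :
    'M[R]_(m, n) :=
  \matrix_(i, j) 'D_(delta_mx j 0) (fun y : 'cV[R]_n => f y i 0) x.

(* Continuous differentiability in the closure of an open set: f is C^1 in the
   open set, and f and its Jacobian extend continuously to the closure. The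
   values of f off the closure are irrelevant. *)
Definition C1_on_closure (R : realType) m n (Omega : set 'cV[R]_n)
    (f : 'cV[R]_n -> 'cV[R]_m) : Prop :=
  [/\ {within closure Omega, continuous f},
      forall x, Omega x -> differentiable f x
    & exists2 J : 'cV[R]_n -> 'M[R]_(m, n),
        {within closure Omega, continuous J} &
        forall x, Omega x -> J x = jac f x].

(* The continuous extension of the Jacobian to the closure of Omega. For x in
   Omega the filter does not exclude x, so that under [C1_on_closure] the limit
   is [jac f x] itself. *)
Definition cjac (R : realType) m n (Omega : set 'cV[R]_n)
    (f : 'cV[R]_n -> 'cV[R]_m) (x : 'cV[R]_n) : 'M[R]_(m, n) :=
  lim (jac f y @[y --> within Omega (nbhs x)]).

Definition pack (R : realType) N (u : 'cV[R]_N) (lambda : R) : 'cV[R]_(N + 1) :=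
  col_mx u lambda%:M.

Section Continuation.
Variables (R : realType) (N : nat).
Implicit Types (Omega : set 'cV[R]_(N + 1)) (G : 'cV[R]_(N + 1) -> 'cV[R]_N).

Definition G_u Omega G (x : 'cV[R]_(N + 1)) : 'M[R]_N := lsubmx (cjac Omega G x).

Definition G_lambda Omega G (x : 'cV[R]_(N + 1)) : 'cV[R]_N :=
  rsubmx (cjac Omega G x).

(* "pal" abbreviates "pseudo-arclength". *)
Definition pal_normalization (x0 dx0 : 'cV[R]_(N + 1)) (s0 : R)
    (x : 'cV[R]_(N + 1)) (s : R) : R :=
  vdot dx0 (x - x0) - (s - s0).

Definition pal_map G (x0 dx0 : 'cV[R]_(N + 1)) (s0 : R)
    (x : 'cV[R]_(N + 1)) (s : R) : 'cV[R]_(N + 1) :=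
  pack (G x) (pal_normalization x0 dx0 s0 x s).

Definition F_x Omega G (x0 dx0 : 'cV[R]_(N + 1)) (s0 : R)
    (x : 'cV[R]_(N + 1)) (s : R) : 'M[R]_(N + 1) :=
  cjac Omega (fun y => pal_map G x0 dx0 s0 y s) x.

End Continuation.

(* The two smallest singular values need dimension N >= 2, i.e. N = n.+2; the
   1-based indices N and N-1 are [ord_max] and [inord n]. *)
Definition sv_N (R : realType) n (sigma : 'rV[R]_n.+2) : R := sigma 0 ord_max.

Definition sv_N1 (R : realType) n (sigma : 'rV[R]_n.+2) : R := sigma 0 (inord n).

Definition sv_gap (R : realType) n (sigma : 'rV[R]_n.+2) : R :=
  sv_N1 sigma ^+ 2 - sv_N sigma ^+ 2.

Definition xi (R : realType) N (uN g : 'cV[R]_N) : R :=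
  `|vdot uN g| + enorm ((1%:M - uN *m uN^T) *m g).

(* When gap and xi both vanish the quotient below is 0 / 0 = 0; its factor
   (u_N^T G_lambda)^2 is then 0 as well. *)
Definition fold_quantity (R : realType) n
    (sigma : 'rV[R]_n.+2) (uN g : 'cV[R]_n.+2) : R :=
  Num.max (sv_N sigma ^+ 2)
    (vdot uN g ^+ 2 * (sv_gap sigma / (sv_gap sigma + xi uN g ^+ 2))).

(* Main.v *)
Require Import Defs.
From HB Require Import structures.
From mathcomp Require Import all_boot all_order all_algebra.
From mathcomp Require Import all_classical all_reals all_analysis.
Set Implicit Arguments.
Unset Strict Implicit.
Unset Printing Implicit Defensive.
Import Order.TTheory GRing.Theory Num.Theory.
Import numFieldNormedType.Exports.
Local Open Scope classical_set_scope.
Local Open Scope ring_scope.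

(** Border the splitting of [G_u].  Since the normalization is affine in [x]
    with gradient [dx0], the Jacobian of the extended map is
      F_x = ( G_u     G_lambda )
            ( du0^T   dlambda0 )
    whatever [s] is ([F_xE]).  Substituting [G_u = I + K + E],
      F_x - I = ( K       G_lambda     )  +  ( E  0 )
                ( du0^T   dlambda0 - 1 )     ( 0  0 ).
    The first matrix is taken as the low-rank part: bordering [K] by one
    column and one row adds at most one to the rank each time
    ([mxrank_bordered]).  The second one is the residual, and padding by zeros
    does not increase the operator norm ([opnorm_block_mx0]).

    The one analytic point is that the Jacobians on the closure of [Omega] are
    limits from inside [Omega]: the formula for [F_x] holds at the level of
    Jacobians everywhere ([jac_pal_map]), and it passes to the limit because
    the Jacobian of [G] converges ([jac_cvg_cjac]) and appending fixed rows is
    continuous ([continuous_col_mx]). *)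

(** The difference quotient along the line is the constant [c] away from
    [h = 0], where it is [0] because [0^-1 = 0]; the limit excludes [h = 0]. *)
Lemma derive_affine (R : realType) (V W : normedModType R) (f : V -> W)
    (x v : V) (c : W) :
  (forall h : R, f (h *: v + x) - f x = h *: c) -> 'D_v f x = c.
Proof.
move=> f_affine; apply: cvg_lim => //; apply: cvg_near_cst.
near=> h; have h0 : h != 0 by near: h; exact: nbhs_dnbhs_neq.
by rewrite /= f_affine scalerA mulVf ?scale1r.
Unshelve. all: by end_near. Qed.

Lemma jac_pack (R : realType) m n (f : 'cV[R]_n -> 'cV[R]_m)
    (g : 'cV[R]_n -> R) (x : 'cV[R]_n) :
  jac (fun y => pack (f y) (g y)) x =
  col_mx (jac f x) (\row_j 'D_(delta_mx j 0) g x).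
Proof.
apply/matrixP => i j; rewrite !mxE; case: split_ordP => k ->; rewrite !mxE.
  by congr (derive _ _ _); apply/funext => y; rewrite /pack col_mxEu.
congr (derive _ _ _); apply/funext => y.
by rewrite /pack col_mxEd mxE !ord1.
Qed.

Lemma derive_pal_normalization (R : realType) N (x0 dx0 : 'cV[R]_(N + 1))
    (s0 s : R) (x v : 'cV[R]_(N + 1)) :
  'D_v (fun y => pal_normalization x0 dx0 s0 y s) x = vdot dx0 v.
Proof.
apply: derive_affine => h; rewrite /pal_normalization /vdot.
have -> : h *: v + x - x0 = h *: v + (x - x0) by rewrite addrA.
by rewrite mulmxDr -scalemxAr mxE [in X in X + _]mxE -[h * _ + _ - _]addrA addrK.
Qed.

(** Differentiation is entrywise: the top rows are the entries of [G] itself, and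
    the last row is the gradient of an affine function, hence constant.  This
    holds at every [x], so the functions on the two sides can be exchanged
    under the limit that defines [F_x]. *)
Lemma jac_pal_map (R : realType) N (G : 'cV[R]_(N + 1) -> 'cV[R]_N)
    (x0 dx0 : 'cV[R]_(N + 1)) (s0 s : R) (x : 'cV[R]_(N + 1)) :
  jac (fun y => pal_map G x0 dx0 s0 y s) x = col_mx (jac G x) dx0^T.
Proof.
rewrite /pal_map jac_pack; congr col_mx; apply/rowP => j.
by rewrite mxE derive_pal_normalization /vdot -colE !mxE.
Qed.

(** [cjac] is defined as a limit, which is a default value if there is no
    limit; the continuous extension provided by [C1_on_closure] is what makes
    it exist, at boundary points included. *)
Lemma jac_cvg_cjac (R : realType) m n (Omega : set 'cV[R]_n)
    (f : 'cV[R]_n -> 'cV[R]_m) (x : 'cV[R]_n) :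
  C1_on_closure Omega f -> closure Omega x ->
  jac f y @[y --> within Omega (nbhs x)] --> cjac Omega f x.
Proof.
move=> [_ _ [J /subspace_continuousP Jcont J_jac]] clx.
suff jacJ : jac f y @[y --> within Omega (nbhs x)] --> J x.
  have FF := within_nbhs_proper clx.
  by have -> : cjac Omega f x = J x by apply: cvg_lim.
apply: cvg_trans (cvg_trans (cvg_app J _) (Jcont x clx)); last first.
  exact: within_subset (@subset_closure _ Omega).
by apply: near_eq_cvg; rewrite near_withinE; apply: nearW => y /J_jac.
Qed.

Lemma continuous_col_mx (T : topologicalType) m1 m2 n (B : 'M[T]_(m2, n)) :
  continuous (fun A : 'M[T]_(m1, n) => col_mx A B).
Proof.
move=> A S [Q nbhsQ QS]; exists (fun i j => Q (lshift m2 i) j).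
  by move=> i j; have := nbhsQ (lshift m2 i) j; rewrite col_mxEu.
move=> A' QA'; apply: QS => i j; case: (split_ordP i) => k ->.
  by rewrite col_mxEu.
(* The bottom entries do not move, hence stay in any of their neighborhoods. *)
have := nbhsQ (rshift m1 k) j; rewrite !col_mxEd; exact: nbhs_singleton.
Qed.

Lemma F_xE (R : realType) N (Omega : set 'cV[R]_(N + 1))
    (G : 'cV[R]_(N + 1) -> 'cV[R]_N) (x0 dx0 : 'cV[R]_(N + 1)) (s0 s : R)
    (x : 'cV[R]_(N + 1)) :
  C1_on_closure Omega G -> closure Omega x ->
  F_x Omega G x0 dx0 s0 x s = col_mx (cjac Omega G x) dx0^T.
Proof.
move=> G_C1 clx; rewrite /F_x /cjac.
under eq_fun do rewrite jac_pal_map.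
have FF := within_nbhs_proper clx.
apply: cvg_lim => //.
have col_cont := @continuous_col_mx R N 1 (N + 1) dx0^T (cjac Omega G x).
exact: (cvg_comp _ _ (jac_cvg_cjac G_C1 clx) col_cont).
Qed.

Lemma enorm_col_mx0 (R : realType) m n (v : 'cV[R]_m) :
  enorm (col_mx v (0 : 'cV[R]_n)) = enorm v.
Proof.
rewrite /enorm big_split_ord /=; congr Num.sqrt.
rewrite [X in _ + X]big1 ?addr0; last by move=> i _; rewrite col_mxEd mxE expr0n.
by apply: eq_bigr => i _; rewrite col_mxEu.
Qed.

Lemma enorm_usubmx (R : realType) m n (v : 'cV[R]_(m + n)) :
  enorm (usubmx v) <= enorm v.
Proof.
rewrite /enorm ler_wsqrtr// big_split_ord /= ler_wpDr//.
  by apply: sumr_ge0 => i _; exact: sqr_ge0.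
by apply: ler_sum => i _; rewrite mxE.
Qed.

(** The supremum of an unbounded set of reals is a default value, so that
    comparing operator norms requires knowing that these sets are bounded.  On
    the unit ball every coordinate is at most 1 in absolute value, which bounds
    each entry of [A *m v] by the absolute sum of the row. *)
Lemma opnorm_set_has_sup (R : realType) m n (A : 'M[R]_(m, n)) :
  has_sup [set enorm (A *m v) | v in [set v : 'cV[R]_n | enorm v <= 1]].
Proof.
split.
  exists (enorm (A *m 0)); exists 0 => //=.
  by rewrite /enorm big1 ?sqrtr0// => i _; rewrite mxE expr0n.
exists (Num.sqrt (\sum_i (\sum_j `|A i j|) ^+ 2)) => _ [v /= v1 <-].
have v_le1 j : `|v j 0| <= 1.
  apply: le_trans v1; rewrite -sqrtr_sqr /enorm ler_wsqrtr//.
  by rewrite (bigD1 j)//= lerDl; apply: sumr_ge0 => i _; exact: sqr_ge0.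
rewrite /enorm ler_wsqrtr//; apply: ler_sum => i _.
rewrite -[X in X <= _]real_normK ?num_real// lerXn2r ?nnegrE//.
  exact: sumr_ge0.
rewrite mxE; apply: le_trans (ler_norm_sum _ _ _) _.
by apply: ler_sum => j _; rewrite normrM ler_piMr.
Qed.

(** The padded matrix acts on the top part of a vector only, whose norm
    is at most that of the vector: it sends the unit ball into the image of the unit
    ball by [A]. *)
Lemma opnorm_block_mx0 (R : realType) m1 m2 n1 n2 (A : 'M[R]_(m1, n1)) :
  opnorm (block_mx A 0 0 (0 : 'M[R]_(m2, n2))) <= opnorm A.
Proof.
apply: sup_le; last exact: opnorm_set_has_sup.
  move=> _ [v /= v1 <-]; apply: le_down; exists (usubmx v) => /=.
    exact: le_trans (enorm_usubmx v) v1.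
  by rewrite -[in RHS](vsubmxK v) mul_block_col !mul0mx !addr0 enorm_col_mx0.
by have [] := opnorm_set_has_sup (block_mx A 0 0 (0 : 'M[R]_(m2, n2))).
Qed.

Lemma mxrank_col_mx (F : fieldType) m1 m2 n
    (A : 'M[F]_(m1, n)) (B : 'M[F]_(m2, n)) :
  (\rank (col_mx A B) <= \rank A + \rank B)%N.
Proof. by rewrite -addsmxE mxrank_adds_leqif. Qed.

Lemma mxrank_bordered (F : fieldType) m n (A : 'M[F]_(m, n)) (b : 'cV[F]_m)
    (c : 'rV[F]_n) (d : 'M[F]_1) :
  (\rank (block_mx A b c d) <= \rank A + 2)%N.
Proof.
apply: leq_trans (mxrank_col_mx _ _) _.
(* The two units of the bound are the bottom row and the right column. *)
rewrite (addnA _ 1 1) leq_add ?rank_leq_row//.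
rewrite -mxrank_tr tr_row_mx; apply: leq_trans (mxrank_col_mx _ _) _.
by rewrite mxrank_tr leq_add ?rank_leq_row.
Qed.

Theorem theorem4p1 (R : realType) (n : nat)
    (Omega : set 'cV[R]_(n.+2 + 1)) (Omega_open : open Omega)
    (G : 'cV[R]_(n.+2 + 1) -> 'cV[R]_n.+2)
    (G_C1 : C1_on_closure Omega G)
    (U V : 'cV[R]_(n.+2 + 1) -> 'M[R]_n.+2)
    (sigma : 'cV[R]_(n.+2 + 1) -> 'rV[R]_n.+2)
    (G_u_svd : forall x : 'cV[R]_(n.+2 + 1), closure Omega x ->
       is_svd (G_u Omega G x) (U x) (sigma x) (V x))
    (u0 du0 : 'cV[R]_n.+2) (lambda0 dlambda0 s0 : R)
    (x0_closure : closure Omega (pack u0 lambda0))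
    (G_x0 : G (pack u0 lambda0) = 0)
    (N_x0 : pal_normalization (pack u0 lambda0) (pack du0 dlambda0) s0
              (pack u0 lambda0) s0 = 0)
    (dx0_unit : enorm (pack du0 dlambda0) = 1)
    (tau : R) (tau_ge0 : 0 <= tau)
    (tau_bound : forall x : 'cV[R]_(n.+2 + 1), closure Omega x ->
       enorm (G_u Omega G x *m du0 + dlambda0 *: G_lambda Omega G x) <= tau)
    (alpha : R) (alpha_gt0 : 0 < alpha)
    (fold_bound : forall x : 'cV[R]_(n.+2 + 1), closure Omega x ->
       0 < sv_N1 (sigma x) /\
       alpha <= fold_quantity (sigma x) (col ord_max (U x)) (G_lambda Omega G x))
    (tau_lt_alpha : tau < alpha)
    (u : 'cV[R]_n.+2) (lambda : R)
    (x_closure : closure Omega (pack u lambda))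
    (Ku E : 'M[R]_n.+2) (p : nat)
    (G_u_split : G_u Omega G (pack u lambda) = 1%:M + Ku + E)
    (rank_Ku : \rank Ku = p) :
  exists2 calK : 'M[R]_(n.+2 + 1),
    (\rank calK <= p + 2)%N &
    forall s : R,
      opnorm (F_x Omega G (pack u0 lambda0) (pack du0 dlambda0) s0
                (pack u lambda) s - 1%:M - calK)
      <= opnorm E.
Proof.
set x := pack u lambda.
exists (block_mx Ku (G_lambda Omega G x) du0^T (dlambda0 - 1)%:M).
  by rewrite -rank_Ku mxrank_bordered.
move=> s; rewrite F_xE// /pack tr_col_mx tr_scalar_mx.
rewrite -[cjac Omega G x]hsubmxK -/(G_u Omega G x) -/(G_lambda Omega G x).
(* A column block of row blocks is by definition a [block_mx]. *)
rewrite G_u_split -/(block_mx _ _ _ _) scalar_mx_block.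
rewrite !opp_block_mx !add_block_mx !subr0 !subrr.
have -> : 1%:M + Ku + E - 1%:M - Ku = E by rewrite -addrA -opprD addrAC subrr add0r.
rewrite (_ : _ - 1%:M - _ = 0); last by rewrite raddfB/= subrr.
exact: opnorm_block_mx0.
Qed.
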